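(* Let $k\ge2$ and let $X,Y\subseteq A^*$ be finitely generated right ideals. Then: (1) $Y=_{\sf ess}X$ iff ${\sf id}_Y={\sf id}_X$ in $M_{k,1}$. (2) $Y\subseteq_{\sf end}X$ iff ${\sf id}_Y\le{\sf id}_X$ for the idempotent order of $M_{k,1}$. (3) The $\mathcal R$-order (on the set of $\mathcal R$-classes) of $M_{k,1}$ is embedded in the idempotent order of the partial identity elements of $M_{k,1}$.
   Context: $A$ is an alphabet with $k\ge2$ letters, $A^*$ the free monoid over $A$. A right ideal of $A^*$ is a set $R\subseteq A^*$ with $RA^*\subseteq R$. A right ideal homomorphism is a function $\varphi$ whose domain ${\sf Dom}(\varphi)\subseteq A^*$ is a right ideal, with values in $A^*$ and $\varphi(xw)=\varphi(x)w$ for all $x\in{\sf Dom}(\varphi)$, $w\in A^*$. ${\sf riHom}(A^* )$ is the set of right ideal homomorphisms with finitely generated domain. A right ideal $R'\subseteq R$ is essential in the right ideal $R$ iff $R'$ intersects every nonempty right ideal contained in $R$. $\Phi$ is an essentially equal restriction of $\varphi$ (and $\varphi$ an essentially equal extension of $\Phi$) iff $\Phi$ is a restriction of $\varphi$ and ${\sf Dom}(\Phi)$ is essential in ${\sf Dom}(\varphi)$. Every $\varphi\in{\sf riHom}(A^* )$ has a unique maximal essentially equal extension $\max(\varphi)$. The Thompson-Higman monoid is $M_{k,1}=\{\max(\varphi):\varphi\in{\sf riHom}(A^* )\}$ with multiplication $\psi\varphi=\max(\psi\circ\varphi)$ (functions act on the left); $\varphi$ represents the element $\max(\varphi)$. ${\sf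 ends}(R)\subseteq A^\omega$ is the set of infinite words having some finite prefix in $R$. For finitely generated right ideals, $Y\subseteq_{\sf end}X$ means ${\sf ends}(Y)\subseteq{\sf ends}(X)$, and $Y=_{\sf ess}X$ means ${\sf ends}(Y)={\sf ends}(X)$. ${\sf id}_X$ is the partial identity with domain $X$ (regarded as representing an element of $M_{k,1}$); partial identity elements of $M_{k,1}$ are those represented by some ${\sf id}_X$ with $X$ a finitely generated right ideal. For idempotents $e,f$, the idempotent order is $e\le f$ iff $e=ef=fe$. $u\le_{\mathcal R}v$ means $u=vx$ for some $x\in M_{k,1}$; $\mathcal R$-classes are the classes of the associated equivalence relation. *)

(* Defs.v *)
From HB Require Import structures.
From mathcomp Require Import all_boot.
From mathcomp Require Import boolp classical_sets functions cardinality.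

Set Implicit Arguments.
Unset Strict Implicit.
Unset Printing Implicit Defensive.

Local Open Scope classical_set_scope.

(* Elements of the free monoid A^* are sequences [seq A], multiplied by [++];
   infinite words are functions [nat -> A]; partial functions on A^* are
   option-valued, [None] meaning "undefined". *)

Section RightIdeals.
Variable A : Type.
Implicit Types (R X Y C : set (seq A)) (w x : seq A).

Definition right_ideal R := forall x w, R x -> R (x ++ w).

(* The empty right ideal is finitely generated (by the empty set). *)
Definition fg_right_ideal R :=
  right_ideal R /\
  exists2 C, finite_set C & R = [set x ++ w | x in C & w in [set: seq A]].

Definition essential_in (R' R : set (seq A)) :=
  [/\ right_ideal R', right_ideal R, R' `<=` R &
      forall I, right_ideal I -> I !=set0 -> I `<=` R -> (R' `&` I) !=set0].

Definition ends R : set (nat -> A) :=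
  [set z | exists n, R (mkseq z n)].

Definition sub_end Y X := ends Y `<=` ends X.

Definition eq_ess Y X := ends Y = ends X.

End RightIdeals.

Definition pfun (A : Type) := seq A -> option (seq A).
HB.instance Definition _ (A : Type) := gen_eqMixin (pfun A).
HB.instance Definition _ (A : Type) := gen_choiceMixin (pfun A).

Section ThompsonHigman.
Variable A : Type.
Implicit Types (f g u v e : pfun A) (X : set (seq A)).

Definition Dom f : set (seq A) := [set x | isSome (f x)].

Definition right_ideal_hom f :=
  right_ideal (Dom f) /\
  forall x y w, f x = Some y -> f (x ++ w) = Some (y ++ w).

Definition riHom : set (pfun A) :=
  [set f | right_ideal_hom f /\ fg_right_ideal (Dom f)].

Definition restriction g f := forall x y, g x = Some y -> f x = Some y.

Definition ess_equal_restriction g f :=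
  restriction g f /\ essential_in (Dom g) (Dom f).

Definition maximal_ess_equal_ext f : set (pfun A) :=
  [set g | [/\ riHom g, ess_equal_restriction f g &
     forall h, riHom h -> ess_equal_restriction f h ->
       restriction g h -> h = g]].

(* The default value [f] of [xget] is irrelevant on [riHom], where the maximal
   essentially equal extension exists and is unique. *)
Definition maxext f : pfun A := xget f (maximal_ess_equal_ext f).

(* The underlying set of M_{k,1}, where k is the size of the alphabet. *)
Definition THmonoid : set (pfun A) := maxext @` riHom.

Definition THmul g f : pfun A := maxext (pcomp g f).

Definition pid X : pfun A := fun x => if `[< X x >] then Some x else None.

(* The element of M_{k,1} represented by id_X. *)
Definition THid X : pfun A := maxext (pid X).

Definition partial_identities : set (pfun A) :=
  [set THid X | X in @fg_right_ideal A].

Definition THidempotent e := THmonoid e /\ THmul e e = e.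

Definition idem_le e f :=
  [/\ THidempotent e, THidempotent f, e = THmul e f & e = THmul f e].

Definition Rle u v := exists2 x, THmonoid x & u = THmul v x.

Definition Rclass u : set (pfun A) :=
  [set v | [/\ THmonoid v, Rle u v & Rle v u]].

Definition Rclasses : set (set (pfun A)) := Rclass @` THmonoid.

(* The partial order induced by [Rle] on the R-classes. *)
Definition Rclass_le (P Q : set (pfun A)) :=
  exists u v, [/\ P u, Q v & Rle u v].

End ThompsonHigman.

Definition order_embedding (S T : Type) (P : set S) (leS : S -> S -> Prop)
    (Q : set T) (leT : T -> T -> Prop) (F : S -> T) :=
  [/\ set_fun P Q F, set_inj P F &
      forall x y, P x -> P y -> (leS x y <-> leT (F x) (F y))].

(* Main.v *)
(* For a right ideal homomorphism f with finitely generated domain, the maximal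
   essentially equal extension has the explicit graph "every w extends to some
   w w' with f (x w w') = y w w'".  This turns equality in M_{k,1} into a
   statement about prefixes: id_X represents the partial identity on the closure
   of X, the set of words x all of whose extensions have a further extension in
   X, and by finite generation Y lies in the closure of X iff ends Y is contained
   in ends X.  An element u of M_{k,1} is then sent to the identity on its image,
   since u <=_R v iff ends (Im u) is contained in ends (Im v): for the converse, one
   lifts u through v on the shortest words s with u s in Im v. *)
Require Import Defs.
From mathcomp Require Import all_boot.
From mathcomp Require Import boolp classical_sets functions cardinality.

Set Implicit Arguments.
Unset Strict Implicit.
Unset Printing Implicit Defensive.

Local Open Scope classical_set_scope.

Section ThompsonHigmanTheory.
Variable A : finType.
Implicit Types (R X Y Z : set (seq A)) (f g h u v : pfun A) (s t w x y : seq A).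

Lemma pfun_eqP f g :
  (forall x y, f x = Some y <-> g x = Some y) -> f = g.
Proof.
move=> fg; apply/funext => x; case fx: (f x) => [y|].
  by apply/esym/fg.
by case gx: (g x) => [y|//]; move/fg: gx; rewrite fx.
Qed.

Lemma DomP f x : Dom f x <-> exists y, f x = Some y.
Proof.
rewrite /Dom /=; case: (f x) => [y|]; split=> //; first by exists y.
by case.
Qed.

(** * Finite generation expressed through word length *)

Lemma finite_size_leq N : finite_set [set s : seq A | size s <= N].
Proof.
apply: (@sub_finite_set _ _ (\bigcup_(i in `I_N.+1) range (@tval i A))).
  by move=> s sN; exists (size s) => //=; exists (in_tuple s).
by apply: bigcup_finite => // i _; apply: finite_image; exact: finite_finset.
Qed.

Lemma finite_size_bound (C : set (seq A)) :
  finite_set C -> exists N, forall c, C c -> size c <= N.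
Proof.
move=> /finite_seqP[s ->]; exists (\max_(c <- s) size c) => c /= cs.
by rewrite (big_rem c) //= leq_maxl.
Qed.

Definition stable_from N R :=
  forall s t, N <= size s -> R (s ++ t) -> R s.

(** If [N] bounds the lengths of the generators, a generator that is a prefix of [s ++ t] with
    [N <= size s] is already a prefix of [s]. Conversely, the members of length at most [N]
    generate, and over a finite alphabet they are finitely many. *)
Lemma fg_right_idealP R :
  fg_right_ideal R <-> right_ideal R /\ exists N, stable_from N R.
Proof.
split=> [[rR [C finC defR]]|[rR [N NR]]]; split=> //.
  have [N CN] := finite_size_bound finC; exists N => s t sN.
  rewrite defR => -[c Cc [w _ cw]].
  have cs : size c <= size s by exact: leq_trans (CN _ Cc) sN.
  exists c => //; exists (drop (size c) s) => //.
  rewrite -[RHS](cat_take_drop (size c)); congr (_ ++ _).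
  by rewrite -(takel_cat t cs) -cw take_size_cat.
exists (R `&` [set s | size s <= N]).
  exact/finite_setIr/finite_size_leq.
apply/seteqP; split=> [x Rx|_ [c [Rc _] [w _ <-]]]; last exact: rR.
have [xN|/ltnW Nx] := leqP (size x) N.
  by exists x => //; exists [::] => //; rewrite cats0.
exists (take N x); last by exists (drop N x) => //; rewrite cat_take_drop.
split; last by rewrite /= size_take_min geq_minl.
by apply: (NR _ (drop N x)); rewrite ?cat_take_drop // size_takel.
Qed.

(** * Closures of right ideals and their ends *)

(** For a right ideal [X], this is the largest right ideal in which [X] is essential. *)
Definition closure X : set (seq A) :=
  [set x | forall w, exists w', X (x ++ w ++ w')].

Lemma sub_closure X : right_ideal X -> X `<=` closure X.
Proof. by move=> rX x Xx w; exists [::]; exact: rX. Qed.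

Lemma closure_right_ideal X : right_ideal (closure X).
Proof.
move=> x w clx w1; have [w' clx'] := clx (w ++ w1).
by exists w'; rewrite -catA [w ++ _]catA.
Qed.

Lemma closure_subP X Y :
  right_ideal Y -> Y `<=` closure X <-> closure Y `<=` closure X.
Proof.
move=> rY; split=> [YX y cly w|];
  last by apply: subset_trans; exact: sub_closure.
have [w' /YX/(_ [::])[w'']] := cly w.
by rewrite cat0s -!catA => ?; exists (w' ++ w'').
Qed.

Lemma closureK X : closure (closure X) = closure X.
Proof.
apply/seteqP; split; last exact/sub_closure/closure_right_ideal.
exact/(closure_subP X (@closure_right_ideal X)).
Qed.

Lemma closureI X Y : right_ideal X -> right_ideal Y ->
  closure (X `&` Y) = closure X `&` closure Y.
Proof.
move=> rX rY; apply/seteqP; split=> [x clx|x [clX clY] w].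
  by split=> w; have [w' [? ?]] := clx w; exists w'.
(* First reach [X], then prolong into [Y]; a right ideal is not left by prolonging. *)
have [w1 X1] := clX w; have [w2 Y2] := clY (w ++ w1).
exists (w1 ++ w2); split; first by rewrite !catA; apply: rX; rewrite -catA.
by move: Y2; rewrite -!catA.
Qed.

Lemma mkseq_cat (T : Type) (z : nat -> T) n m :
  mkseq z (n + m) = mkseq z n ++ mkseq (fun i => z (n + i)) m.
Proof.
rewrite /mkseq iotaD map_cat add0n; congr (_ ++ _).
by rewrite -{1}(addn0 n) iotaDl -map_comp.
Qed.

Lemma mkseq_nth_cat (a : A) s n :
  exists t, mkseq (nth a s) (size s + n) = s ++ t.
Proof. by rewrite mkseq_cat mkseq_nth; eexists. Qed.

Lemma sub_endP X Y : 0 < #|A| -> right_ideal Y -> fg_right_ideal X ->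
  sub_end Y X <-> Y `<=` closure X.
Proof.
case/card_gt0P=> a _ rY /fg_right_idealP[rX [N NX]].
split=> [YX y Yy w|YX z [n /YX zn]].
  (* [nth a (y ++ w)] is the infinite word [y w a a a ...]. Its prefix in [X] may be shorter than
     [y ++ w], hence the prolongation below. *)
  have [|n Xn] := YX (nth a (y ++ w)).
    by exists (size (y ++ w)); rewrite mkseq_nth; apply: rY.
  have [t def_t] := mkseq_nth_cat a (y ++ w) n.
  by exists t; rewrite catA -def_t addnC mkseq_cat; apply: rX.
(* Reading [N] more letters of [z] makes the prefix long enough for stability to remove [w']. *)
have [w' Xw'] := zn (mkseq (fun i => z (n + i)) N).
exists (n + N); apply: (NX _ w'); first by rewrite size_mkseq leq_addl.
by rewrite mkseq_cat -catA.
Qed.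

Lemma eq_essP X Y : 0 < #|A| -> fg_right_ideal X -> fg_right_ideal Y ->
  eq_ess Y X <-> closure Y = closure X.
Proof.
move=> A0 fX fY; have [rX rY] : right_ideal X /\ right_ideal Y.
  by case: fX fY => [? _] [].
have YX : ends Y `<=` ends X <-> _ :=
  iff_trans (sub_endP A0 rY fX) (closure_subP X rY).
have XY : ends X `<=` ends Y <-> _ :=
  iff_trans (sub_endP A0 rX fY) (closure_subP Y rX).
split=> e; apply/seteqP; split.
- by apply/YX; rewrite e.
- by apply/XY; rewrite e.
- by apply/YX; rewrite e.
- by apply/XY; rewrite e.
Qed.

(** * Germs and the maximal essentially equal extension *)

Lemma cat_injr w : injective (cat^~ w).
Proof.
move=> x y /= e; have sxy : size x = size y.
  by apply/(@addIn (size w)); rewrite -!size_cat e.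
by move/eqP: e; rewrite eqseq_cat // => /andP[/eqP].
Qed.

Definition germ f x y :=
  forall w, exists w', f (x ++ w ++ w') = Some (y ++ w ++ w').

(** Prolonging a witness of the first germ to a witness of the second gives two expressions for one
    value of [f]; their common suffix cancels. *)
Lemma germ_uniq f x y1 y2 : germ f x y1 -> germ f x y2 -> right_ideal_hom f ->
  y1 = y2.
Proof.
move=> g1 g2 [_ hf]; have [w1 /hf e1] := g1 [::]; have [w2] := g2 w1.
have := e1 w2; rewrite -!catA /= => -> [].
exact: cat_injr.
Qed.

Lemma germ_cat f x y w : germ f x y -> germ f (x ++ w) (y ++ w).
Proof.
move=> g w1; have [w' gw'] := g (w ++ w1).
by exists w'; move: gw'; rewrite -!catA.
Qed.

Lemma hom_germ f x y : right_ideal_hom f -> f x = Some y -> germ f x y.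
Proof. by move=> [_ hf] fx w; exists [::]; exact: hf. Qed.

Lemma germ_sub f g x y :
  (forall s t, f s = Some t -> germ g s t) -> germ f x y -> germ g x y.
Proof.
move=> fg gf w; have [w' /fg/(_ [::])[w'']] := gf w.
by rewrite cat0s -!catA => ?; exists (w' ++ w'').
Qed.

Lemma riHom_hom f : riHom f -> right_ideal_hom f.
Proof. by case. Qed.

Lemma riHomP f :
  riHom f <-> right_ideal_hom f /\ exists N, stable_from N (Dom f).
Proof.
by split=> [[hf /fg_right_idealP[]]|[hf [N Nf]]]; split=> //;
  apply/fg_right_idealP; split; [case: hf|exists N].
Qed.

Lemma homP f : (forall x y w, f x = Some y -> f (x ++ w) = Some (y ++ w)) ->
  right_ideal_hom f.
Proof.
by move=> hf; split=> // x w /DomP[y /hf fxy]; apply/DomP; exists (y ++ w).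
Qed.

Definition germ_fun f : pfun A := fun x =>
  if pselect (exists y, germ f x y) is left ex then Some (projT1 (cid ex))
  else None.

Lemma germ_funP f x y : right_ideal_hom f ->
  germ_fun f x = Some y <-> germ f x y.
Proof.
move=> hf; rewrite /germ_fun; case: pselect => [ex|nex].
  case: cid => y' gy' /=; split=> [[<-] //|gy].
  by rewrite (germ_uniq gy gy').
by split=> // gy; case: nex; exists y.
Qed.

Lemma germ_fun_riHom f : riHom f -> riHom (germ_fun f).
Proof.
move=> /riHomP[hf [N Nf]]; apply/riHomP; split.
  by apply: homP => x y w /(germ_funP _ _ hf)/(germ_cat w)/(germ_funP _ _ hf).
(* Beyond length N the germ extends nothing: a word with an extension in
   [Dom f] is already in [Dom f]. *)
exists N => s t sN /DomP[y /(germ_funP _ _ hf)/(_ [::])[w' fw']].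
have /DomP[y' fy'] : Dom f s.
  apply: (Nf _ (t ++ w')) => //.
  by apply/DomP; rewrite catA; eexists; exact: fw'.
by apply/DomP; exists y'; apply/(germ_funP _ _ hf)/hom_germ.
Qed.

Lemma ess_equal_germ f g x y : right_ideal_hom g ->
  ess_equal_restriction f g -> g x = Some y -> germ f x y.
Proof.
move=> [rg hg] [fg [_ _ _ essf]] gx w.
(* Essentiality is applied to the right ideal generated by [x ++ w]. *)
have [|||s [/DomP[y' fs] [w' _ def_s]]] := essf [set x ++ w ++ w' | w' in setT].
- by move=> _ w1 [w' _ <-]; exists (w' ++ w1) => //; rewrite -!catA.
- by exists (x ++ w ++ [::]); exists [::].
- by move=> _ [w' _ <-]; apply/rg/DomP; exists y.
exists w'; move: fs; rewrite -def_s => fs.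
by rewrite fs; have := fg _ _ fs; rewrite (hg _ _ _ gx).
Qed.

Lemma ess_equal_germ_fun f : riHom f -> ess_equal_restriction f (germ_fun f).
Proof.
move=> hf; have [[rf _] _] := hf.
have sub x y : f x = Some y -> germ_fun f x = Some y.
  by move=> fx; apply/germ_funP/hom_germ => //; exact: riHom_hom.
split=> //; split=> //; first by case: (germ_fun_riHom hf) => [[]].
  by move=> x /DomP[y /sub fx]; apply/DomP; exists y.
move=> I rI [x Ix] /(_ _ Ix)/DomP[y /(germ_funP _ _ (riHom_hom hf))/(_ [::])].
move=> [w' fw']; exists (x ++ w'); split; last exact: rI.
by apply/DomP; eexists; exact: fw'.
Qed.

(** By [ess_equal_germ], every essentially equal extension of [f] is a restriction of [germ_fun f],
    which is therefore the greatest one and so the only maximal one. *)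
Lemma maxext_germ f : riHom f -> maxext f = germ_fun f.
Proof.
move=> hf; have hm := germ_fun_riHom hf; have em := ess_equal_germ_fun hf.
have sub h : riHom h -> ess_equal_restriction f h -> restriction h (germ_fun f).
  move=> hh eh x y hx; apply/(germ_funP _ _ (riHom_hom hf)).
  exact: ess_equal_germ (riHom_hom hh) eh hx.
rewrite /maxext; apply: xget_unique => [|h [hh eh maxh]].
  split=> // h hh eh mh; apply: pfun_eqP => x y.
  by split=> [/(sub _ hh eh)|/mh].
by apply/esym/maxh => //; exact: sub.
Qed.

Lemma maxextP f x y : riHom f -> maxext f x = Some y <-> germ f x y.
Proof. by move=> hf; rewrite maxext_germ //; apply/germ_funP/riHom_hom. Qed.

Lemma maxext_riHom f : riHom f -> riHom (maxext f).
Proof. by move=> hf; rewrite maxext_germ //; exact: germ_fun_riHom. Qed.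

(** Equality in the monoid can be tested on representatives: [germ_sub] carries the comparison from
    values to germs. *)
Lemma eq_maxext f g : riHom f -> riHom g ->
    (forall x y, f x = Some y -> germ g x y) ->
    (forall x y, g x = Some y -> germ f x y) ->
  maxext f = maxext g.
Proof.
move=> hf hg fg gf; apply: pfun_eqP => x y; rewrite !maxextP //.
by split; exact: germ_sub.
Qed.

Lemma maxextK f : riHom f -> maxext (maxext f) = maxext f.
Proof.
move=> hf; apply: eq_maxext => //; first exact: maxext_riHom.
  by move=> x y /maxextP; exact.
move=> x y fx; apply: hom_germ; first exact/riHom_hom/maxext_riHom.
by apply/maxextP => //; apply: hom_germ => //; exact: riHom_hom.
Qed.

Lemma THmonoid_riHom u : THmonoid u -> riHom u.
Proof. by move=> [f hf <-]; exact: maxext_riHom. Qed.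

Lemma THmonoid_maxext u : THmonoid u -> maxext u = u.
Proof. by move=> [f hf <-]; exact: maxextK. Qed.

(** * Preimages and composition *)

Lemma preimage_right_ideal f Z : right_ideal_hom f -> right_ideal Z ->
  right_ideal [set s | exists2 t, f s = Some t & Z t].
Proof.
by move=> [_ hf] rZ s w [t /hf fs Zt]; exists (t ++ w); [exact: fs|exact: rZ].
Qed.

Lemma preimage_fg f Z : riHom f -> fg_right_ideal Z ->
  fg_right_ideal [set s | exists2 t, f s = Some t & Z t].
Proof.
move=> /riHomP[hf [N Nf]] /fg_right_idealP[rZ [M MZ]].
apply/fg_right_idealP; split; first exact: preimage_right_ideal.
(* The first [N] letters already lie in the domain, and [f] copies the later ones, at least [M] of
   them, so that [f s] is long enough for the stability of [Z]. *)
exists (N + M) => s w sNM [t fsw Zt].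
have Ns : N <= size s by exact: leq_trans (leq_addr _ _) sNM.
have /DomP[y fy] : Dom f (take N s).
  apply: (Nf _ (drop N s ++ w)); first by rewrite size_takel.
  by apply/DomP; exists t; rewrite catA cat_take_drop.
have := hf.2 _ _ (drop N s) fy; rewrite cat_take_drop => fs.
exists (y ++ drop N s) => //; apply: (MZ _ w).
  by rewrite size_cat size_drop (leq_trans _ (leq_addl _ _)) // leq_subRL.
by have := hf.2 _ _ w fs; rewrite fsw => -[<-].
Qed.

Lemma pcompP (g f : pfun A) x z :
  pcomp g f x = Some z <-> exists2 y, f x = Some y & g y = Some z.
Proof.
rewrite /pcomp; case: (f x) => [y|] /=; last by split=> // -[].
by split=> [gy|[_ [<-]]//]; exists y.
Qed.

Lemma pcomp_riHom g f : riHom g -> riHom f -> riHom (pcomp g f).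
Proof.
move=> hg hf; have [[_ cf] _] := hf; have [[_ cg] dg] := hg; split.
  apply: homP => x z w /pcompP[y /cf fx /cg gy].
  by apply/pcompP; exists (y ++ w); [exact: fx|exact: gy].
suff -> : Dom (pcomp g f) = [set s | exists2 t, f s = Some t & Dom g t].
  exact: preimage_fg.
apply/seteqP; split=> x /=.
  by move=> /DomP[z /pcompP[y fx gy]]; exists y => //; apply/DomP; exists z.
by move=> [y fx /DomP[z gy]]; apply/DomP; exists z; apply/pcompP; exists y.
Qed.

(** * Partial identities and the idempotent order *)

Lemma pidP X x y : pid X x = Some y <-> X x /\ x = y.
Proof.
rewrite /pid; case: asboolP => Xx; first by split=> [[<-]|[_ <-]].
by split=> // -[].
Qed.

Lemma pid_riHom X : fg_right_ideal X -> riHom (pid X).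
Proof.
move=> fX; have [rX _] := fX; split.
  by apply: homP => x y w /pidP[Xx <-]; apply/pidP; split=> //; exact: rX.
suff -> : Dom (pid X) = X by [].
apply/seteqP; split=> x; first by move=> /DomP[y /pidP[]].
by move=> Xx; apply/DomP; exists x; exact/pidP.
Qed.

Lemma THidE X : fg_right_ideal X -> THid X = pid (closure X).
Proof.
move=> fX; apply: pfun_eqP => x y; rewrite maxextP; last exact: pid_riHom.
rewrite pidP; split=> [g|[clx <-] w]; last first.
  by have [w' Xw'] := clx w; exists w'; exact/pidP.
split; last by have [w' /pidP[_]] := g [::]; exact: cat_injr.
by move=> w; have [w' /pidP[? _]] := g w; exists w'.
Qed.

Lemma pid_inj X Y : pid X = pid Y -> X = Y.
Proof.
suff sub Z W : pid Z = pid W -> Z `<=` W.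
  by move=> e; apply/seteqP; split; exact: sub.
by move=> e x Zx; have /pidP[] : pid W x = Some x by rewrite -e; exact/pidP.
Qed.

Lemma THid_eqP X Y : fg_right_ideal X -> fg_right_ideal Y ->
  THid Y = THid X <-> closure Y = closure X.
Proof. by move=> fX fY; rewrite !THidE //; split=> [/pid_inj|->]. Qed.

Lemma closure_fg X : fg_right_ideal X -> fg_right_ideal (closure X).
Proof.
move=> /fg_right_idealP[rX [N NX]].
apply/fg_right_idealP; split; first exact: closure_right_ideal.
exists N => s t sN /(_ [::])[w' Xw']; apply: sub_closure => //.
by apply: (NX _ (t ++ w')) => //; rewrite catA.
Qed.

Lemma setI_fg X Y : fg_right_ideal X -> fg_right_ideal Y ->
  fg_right_ideal (X `&` Y).
Proof.
move=> /fg_right_idealP[rX [N NX]] /fg_right_idealP[rY [M MY]].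
apply/fg_right_idealP; split=> [x w [Xx Yx]|]; first by split; auto.
exists (maxn N M) => s t; rewrite geq_max => /andP[sN sM] [Xs Ys].
by split; [exact: NX sN Xs|exact: MY sM Ys].
Qed.

(** Closure commutes with binary intersection, so composing the identities on two closures gives the
    identity on a closed set, which is already maximal. *)
Lemma THmul_id X Y : fg_right_ideal X -> fg_right_ideal Y ->
  THmul (THid X) (THid Y) = THid (X `&` Y).
Proof.
move=> fX fY; rewrite [THid X]THidE // [THid Y]THidE // /THmul.
have -> : pcomp (pid (closure X)) (pid (closure Y)) = pid (closure (X `&` Y)).
  apply: pfun_eqP => x z; rewrite pcompP pidP closureI;
    try by case: fX fY => ? _ [].
  split=> [[y /pidP[Yx <-] /pidP[Xx <-]] //|[[Xx Yx] <-]].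
  by exists x; apply/pidP.
rewrite -/(THid _) THidE ?closureK -?THidE //; last apply: closure_fg;
  exact: setI_fg.
Qed.

Lemma THid_idempotent X : fg_right_ideal X -> THidempotent (THid X).
Proof.
move=> fX; split; last by rewrite THmul_id // setIid.
by exists (pid X) => //; exact: pid_riHom.
Qed.

(** Products being intersections, the order relation becomes the equation between [closure Y] and
    [closure Y] intersected with [closure X]. *)
Lemma idem_leP X Y : fg_right_ideal X -> fg_right_ideal Y ->
  idem_le (THid Y) (THid X) <-> closure Y `<=` closure X.
Proof.
move=> fX fY; have [rX _] := fX; have [rY _] := fY.
rewrite /idem_le !THmul_id // [X `&` Y]setIC.
have fXY := setI_fg fY fX; split=> [[_ _ e _]|sYX].
  move/(THid_eqP fXY fY): e; rewrite closureI // => ->.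
  exact: subIsetr.
have e : THid Y = THid (Y `&` X).
  by apply/THid_eqP => //; rewrite closureI //; apply/esym/setIidPl.
by split=> //; exact: THid_idempotent.
Qed.

(** * Images and the R-order *)

Definition Im f : set (seq A) := [set y | exists x, f x = Some y].

Lemma Im_fg f : riHom f -> fg_right_ideal (Im f).
Proof.
move=> [[_ hf] [_ [C finC defC]]]; split.
  by move=> y w [x /hf fx]; exists (x ++ w).
(* The images of the generators generate; these lie in the domain, so the default [[::]] is never
   taken. *)
exists ((fun c => odflt [::] (f c)) @` C); first exact: finite_image.
have domC c : C c -> Dom f c.
  by move=> Cc; rewrite defC; exists c => //; exists [::] => //; rewrite cats0.
apply/seteqP; split=> [y [x fx]|_ [_ [c Cc <-] [w _ <-]]].
  have : Dom f x by apply/DomP; exists y.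
  rewrite {1}defC => -[c Cc [w _ def_x]]; exists (odflt [::] (f c)).
    by exists c.
  exists w => //; have /DomP[z fc] := domC _ Cc.
  by have := hf _ _ w fc; rewrite def_x fx fc => -[->].
by have /DomP[z fc] := domC _ Cc; exists (c ++ w); rewrite fc; exact: hf.
Qed.

Lemma Rle_Im u v : riHom v -> Rle u v -> Im u `<=` closure (Im v).
Proof.
move=> hv [x /THmonoid_riHom hx ->] y [s /maxextP - /(_ (pcomp_riHom hv hx)) g] w.
by have [w' /pcompP[t _ vt]] := g w; exists w'; exists t.
Qed.

(** A right factor may be replaced by any representative, so [Im_Rle] can work with an explicit
    lift. *)
Lemma THmul_maxextr v f : riHom v -> riHom f ->
  THmul v (maxext f) = THmul v f.
Proof.
move=> hv hf; have hm := maxext_riHom hf; apply: eq_maxext.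
- exact: pcomp_riHom.
- exact: pcomp_riHom.
- move=> x z /pcompP[y /(maxextP _ _ hf) gy vy] w.
  have [w' fw'] := gy w; exists w'; apply/pcompP; exists (y ++ w ++ w') => //.
  exact: (riHom_hom hv).2.
move=> x z /pcompP[y fx vy]; apply: hom_germ; first exact/riHom_hom/pcomp_riHom.
apply/pcompP; exists y => //; apply/maxextP => //.
by apply: hom_germ => //; exact: riHom_hom.
Qed.

(* The shortest prefix of a word lying in a right ideal is unchanged when the
   word is extended, so any choice of values on the words that have no proper
   prefix in the ideal extends to a homomorphism. *)
Definition shortest Z s :=
  find (fun n => `[< Z (take n s) >]) (iota 0 (size s).+1).

Lemma shortestP Z s : Z s -> Z (take (shortest Z s) s) /\ shortest Z s <= size s.
Proof.
move=> Zs; set p := fun n => `[< Z (take n s) >].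
have hp : has p (iota 0 (size s).+1).
  apply/hasP; exists (size s); first by rewrite mem_iota /= add0n.
  by apply/asboolP; rewrite take_size.
have lt : shortest Z s < (size s).+1.
  by have := hp; rewrite has_find size_iota.
split=> //; have := nth_find 0 hp; rewrite nth_iota // add0n.
by move/asboolP.
Qed.

Lemma shortest_cat Z s w : Z s -> shortest Z (s ++ w) = shortest Z s.
Proof.
(* The lengths up to [size s] are searched first, and one of them succeeds. *)
move=> Zs; rewrite /shortest size_cat -addSn iotaD find_cat.
set p := fun n => _; have -> : has p (iota 0 (size s).+1).
  apply/hasP; exists (size s); first by rewrite mem_iota /= add0n.
  by apply/asboolP; rewrite take_size_cat.
apply: eq_in_find => n; rewrite mem_iota /= add0n ltnS => ns.
by rewrite /p takel_cat.
Qed.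

Lemma extend_shortest Z (c : seq A -> seq A) : fg_right_ideal Z ->
  exists2 f, riHom f & forall s t, f s = Some t <->
    Z s /\ t = c (take (shortest Z s) s) ++ drop (shortest Z s) s.
Proof.
move=> fZ; have [rZ _] := fZ.
pose f : pfun A := fun s => if `[< Z s >] then
  Some (c (take (shortest Z s) s) ++ drop (shortest Z s) s) else None.
have fP s t : f s = Some t <->
    Z s /\ t = c (take (shortest Z s) s) ++ drop (shortest Z s) s.
  by rewrite /f; case: asboolP => Zs; split=> //; [case=> <-|case=> _ ->|case].
exists f => //; split.
  apply: homP => s t w /fP[Zs ->]; apply/fP; split; first exact: rZ.
  have [_ le] := shortestP Zs.
  rewrite shortest_cat // takel_cat // drop_cat -catA; congr (_ ++ _).
  (* [drop_cat] tests a strict inequality; in the case of equality the shortest prefix is [s] itself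
     and the dropped word is [w]. *)
  move: le; rewrite leq_eqVlt => /orP[/eqP->|->] //.
  by rewrite ltnn subnn drop0 drop_size.
suff -> : Dom f = Z by [].
apply/seteqP; split=> s; first by move=> /DomP[t /fP[]].
by move=> Zs; apply/DomP; eexists; apply/fP.
Qed.

Lemma Im_Rle u v : THmonoid u -> THmonoid v -> Im u `<=` closure (Im v) ->
  Rle u v.
Proof.
move=> Mu Mv uv; have hu := THmonoid_riHom Mu; have hv := THmonoid_riHom Mv.
have [[_ cu] _] := hu; have [[_ cv] _] := hv.
pose Z := [set s | exists2 t, u s = Some t & Im v t].
have fZ : fg_right_ideal Z by apply: preimage_fg => //; exact: Im_fg.
(* [c] picks a preimage under [v] of [u p] for each [p] in [Z]; elsewhere its value is arbitrary. *)
have /choice[c cP] : forall p, exists q, Z p -> v q = u p.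
  move=> p; have [[t up [q vq]]|nZ] := pselect (Z p); last by exists [::].
  by exists q; rewrite up.
have [f hf fP] := extend_shortest c fZ.
have vf s y : pcomp v f s = Some y <-> Z s /\ u s = Some y.
  (* Both sides agree at the shortest prefix of [s] in [Z], and both copy the remaining letters. *)
  have vfu : Z s -> v (c (take (shortest Z s) s) ++ drop (shortest Z s) s) = u s.
    move=> Zs; have [Zp _] := shortestP Zs; have [t up _] := Zp.
    rewrite (cv _ t); last by rewrite cP.
    by rewrite -(cu _ _ _ up) cat_take_drop.
  rewrite pcompP; split=> [[t /fP[Zs ->]]|[Zs us]]; first by rewrite vfu.
  by eexists; [exact/fP|rewrite vfu].
exists (maxext f); first by exists f.
rewrite THmul_maxextr // -[LHS](THmonoid_maxext Mu).
apply: eq_maxext => //; first exact: pcomp_riHom.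
  (* Here the inclusion of images enters: [t ++ w] extends into [Im v], so [s ++ w] extends into
     [Z], where the composite is [u]. *)
  move=> s t us w; have [|w' [q vq]] := uv t _ w; first by exists s.
  exists w'; apply/vf; split; last exact: cu.
  by exists (t ++ w ++ w'); [exact: cu|exists q].
by move=> s t /vf[_ us]; apply: hom_germ => //; exact: riHom_hom.
Qed.

Lemma RleP u v : THmonoid u -> THmonoid v ->
  Rle u v <-> idem_le (THid (Im u)) (THid (Im v)).
Proof.
move=> Mu Mv; have hu := THmonoid_riHom Mu; have hv := THmonoid_riHom Mv.
have fu := Im_fg hu; have fv := Im_fg hv; have [ru _] := fu.
apply: (iff_trans _ (iff_sym (idem_leP fv fu))).
apply: (iff_trans _ (closure_subP (Im v) ru)).
by split; [exact: Rle_Im|exact: Im_Rle].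
Qed.

(** * Passage to R-classes *)

Lemma Rle_refl u : THmonoid u -> Rle u u.
Proof.
move=> Mu; apply: Im_Rle => //; apply: sub_closure.
by case: (Im_fg (THmonoid_riHom Mu)).
Qed.

Lemma Rle_trans v u (w : pfun A) : THmonoid u -> THmonoid v -> THmonoid w ->
  Rle u v -> Rle v w -> Rle u w.
Proof.
move=> Mu Mv Mw; rewrite !RleP // !idem_leP; try exact/Im_fg/THmonoid_riHom.
exact: subset_trans.
Qed.

Lemma Rclass_eq u v : THmonoid u -> THmonoid v -> Rle u v -> Rle v u ->
  Rclass u = Rclass v.
Proof.
move=> Mu Mv uv vu; apply/seteqP; split=> w [Mw h1 h2]; split=> //.
- exact: Rle_trans vu h1.
- exact: Rle_trans h2 uv.
- exact: Rle_trans uv h1.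
- exact: Rle_trans h2 vu.
Qed.

Lemma Rclass_leP u v : THmonoid u -> THmonoid v ->
  Rclass_le (Rclass u) (Rclass v) <-> Rle u v.
Proof.
move=> Mu Mv; split=> [[u' [v' [[Mu' uu' _] [Mv' _ v'v] u'v']]]|uv].
  exact: Rle_trans uu' (Rle_trans Mu' Mv' Mv u'v' v'v).
by exists u, v; split=> //; split=> //; exact: Rle_refl.
Qed.

(** On an R-class, which is nonempty, a member is chosen and the default is not reached. *)
Definition Rrepr (P : set (pfun A)) : pfun A := xget (fun=> None) P.

Lemma RreprP P : Rclasses P -> THmonoid (Rrepr P) /\ P = Rclass (Rrepr P).
Proof.
move=> [u Mu <-]; rewrite /Rrepr; case: xgetP => [v _ [Mv uv vu]|/(_ u)[]].
  by split=> //; exact: Rclass_eq.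
by split=> //; exact: Rle_refl.
Qed.

Lemma Rclasses_embedding :
  order_embedding (@Rclasses A) (@Rclass_le A) (@partial_identities A)
    (@idem_le A) (fun P => THid (Im (Rrepr P))).
Proof.
split=> [P /RreprP[Mu _]|P Q|P Q].
- by exists (Im (Rrepr P)) => //; exact/Im_fg/THmonoid_riHom.
- rewrite !inE => /RreprP[Mu eP] /RreprP[Mv eQ] e; rewrite eP eQ.
  (* Reflexivity, combined with the equality [e] of the two partial identities, gives both
     inequalities between the representatives. *)
  have idem u : THmonoid u -> idem_le (THid (Im u)) (THid (Im u)).
    by move=> Mu'; apply/RleP => //; exact: Rle_refl.
  by apply: Rclass_eq => //; apply/RleP => //; rewrite e; exact: idem.
move=> /RreprP[Mu eP] /RreprP[Mv eQ].
by rewrite {1}eP {1}eQ Rclass_leP // RleP.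
Qed.

End ThompsonHigmanTheory.

Theorem proposition4p2 (A : finType) (hA : 2 <= #|A|)
    (X Y : set (seq A)) (hX : fg_right_ideal X) (hY : fg_right_ideal Y) :
  [/\ eq_ess Y X <-> THid Y = THid X,
      sub_end Y X <-> idem_le (THid Y) (THid X) &
      exists F : set (pfun A) -> pfun A,
        order_embedding (@Rclasses A) (@Rclass_le A)
                        (@partial_identities A) (@idem_le A) F].
Proof.
have A0 : 0 < #|A| by exact: ltnW.
have [rY _] := hY; split.
- by rewrite eq_essP // THid_eqP.
- apply: (iff_trans (sub_endP A0 rY hX)).
  exact: iff_trans (closure_subP X rY) (iff_sym (idem_leP hX hY)).
- by exists (fun P => THid (Im (Rrepr P))); exact: Rclasses_embedding.
Qed.
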